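(* Let $\mathsf S_n$ ($n\ge1$) denote the Statman tautologies defined in the context. There exist proofs $\Pi_n$ of $\mathsf S_n$ in the CoS proof system $\mathsf{KS}$ whose size is quadratic in the size of the tautology they prove, i.e. $|\Pi_n|\in O(|\mathsf S_n|^2)$.
   Context: Calculus of structures (CoS). Formulae are built from the units $\mathsf f$ (false) and $\mathsf t$ (true), atoms $a,b,c,\dots$ and $\bar a,\bar b,\dots$, and formula variables $A,B,\dots$ and $\bar A,\bar B,\dots$, by binary disjunction $[\alpha\vee\beta]$ and binary conjunction $(\alpha\wedge\beta)$. The map $\bar\cdot$ is an involution on atoms with $\bar a\neq a$, and likewise on formula variables. The De Morgan dual $\bar\alpha$ of a formula is obtained by exchanging $\vee$ with $\wedge$, $\mathsf t$ with $\mathsf f$, and negating every atom and variable. The size $|\alpha|$ of a formula is the number of occurrences of units, atoms and variables in it. A context $\xi\{\ \}$ is a formula with one hole in place of a subformula; $\xi\{\alpha\}$ denotes filling the hole with $\alpha$. A renaming $\rho$ maps atoms to atoms (applied simultaneously, $\bar a\mapsto\overline{\rho(a)}$); a substitution $\sigma$ maps formula variables to formulae (applied simultaneously, $\bar A\mapsto$ dual of $\sigma(A)$). The equality $=$ is the smallest equivalence relation on formulae closed under contexts containing commutativity and associativity of $\vee$ and of $\wedge$, and $[\alpha\vee\mathsf f]=\alpha$, $(\alpha\wedge\mathsf t)=\alpha$, $[\mathsf t\vee\mathsf t]=\mathsf t$, $(\mathsf f\wedge\mathsf f)=\mathsf f$. An inference rule is a pair premiss/conclusion $\alpha/\beta$;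 an instance is $\alpha\rho\sigma/\beta\rho\sigma$; an inference step generated by the rule is $\xi\{\gamma\}/\xi\{\delta\}$ for an instance $\gamma/\delta$ and any context $\xi$. A derivation in a system (finite set of rules) $\mathcal S$ with premiss $\alpha_0$ and conclusion $\alpha_k$ is a chain $\alpha_0,\dots,\alpha_k$ whose successive steps alternate between $=$-steps ($\alpha_i=\alpha_{i+1}$) and steps generated by rules of $\mathcal S$; its size is the total number of occurrences of units, atoms and variables in it. A proof is a derivation with premiss $\mathsf t$. System $\mathsf{KS}$ consists of the rules: atomic interaction $\mathsf t/[a\vee\bar a]$, atomic weakening $\mathsf f/a$, atomic contraction $[a\vee a]/a$ (here $a$ is an atom, instantiated only by renaming), switch $(A\wedge[B\vee C])/[(A\wedge B)\vee C]$ and medial $[(A\wedge B)\vee(C\wedge D)]/([A\vee C]\wedge[B\vee D])$. Statman tautologies. For atoms $c_i,d_i$ ($i\ge1$), let $\alpha_i\equiv[\bar c_i\vee\bar d_i]$; for $n\ge k\ge1$ let $\beta^n_k\equiv\alpha_n\wedge\alpha_{n-1}\wedge\dots\wedge\alpha_k$ (so $\beta^k_k=\alpha_k$ and $\beta^n_k=(\alpha_n\wedge\beta^{n-1}_k)$ for $n>k$); for $n>k\ge1$ let $\gamma^n_k\equiv(\beta^n_{k+1}\wedge c_k)$ and $\delta^n_k\equiv(\beta^n_{k+1}\wedge d_k)$. Then for $n\ge1$, $\mathsf S_n\equiv[\bar\alpha_n\vee[(\gamma^n_{n-1}\wedge\delta^n_{n-1})\vee[\dots\vee[(\gamma^n_1\wedge\delta^n_1)\vee\alpha_1]\dots]]]$,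 where $\bar\alpha_n=(c_n\wedge d_n)$; e.g. $\mathsf S_1=[(c_1\wedge d_1)\vee[\bar c_1\vee\bar d_1]]$. One has $|\mathsf S_n|=2n^2+2$. *)

(* Defs.v *)
From HB Require Import structures.
From mathcomp Require Import all_boot.
From mathcomp Require Import zify.
Set Implicit Arguments.
Unset Strict Implicit.
Unset Printing Implicit Defensive.

(* A literal is a polarity ([true] = positive) together with a name.  Atoms and
   formula variables are two disjoint copies of the literals. *)
Definition literal : Type := (bool * nat)%type.

Definition neg (l : literal) : literal := (~~ l.1, l.2).

Lemma negK : involutive neg.
Proof. by case=> b n; rewrite /neg /= negbK. Qed.

Lemma neg_neq (l : literal) : neg l <> l.
Proof. by case: l => -[] n []. Qed.

Inductive formula : Type :=
| Ff
| Tt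
| Atom of literal
| FVar of literal
| Disj of formula & formula
| Conj of formula & formula.

Lemma formula_comparable : comparable formula.
Proof.
by move=> x y; rewrite /decidable; decide equality; apply: eq_comparable.
Qed.

HB.instance Definition _ := hasDecEq.Build formula (compareP formula_comparable).

Fixpoint dual (x : formula) : formula :=
  match x with
  | Ff => Tt
  | Tt => Ff
  | Atom a => Atom (neg a)
  | FVar v => FVar (neg v)
  | Disj y z => Conj (dual y) (dual z)
  | Conj y z => Disj (dual y) (dual z)
  end.

Fixpoint fsize (x : formula) : nat :=
  match x with
  | Ff | Tt | Atom _ | FVar _ => 1
  | Disj y z | Conj y z => fsize y + fsize z
  end.

Inductive context : Type :=
| Hole
| DisjL of context & formula
| DisjR of formula & context
| ConjL of context & formula
| ConjR of formula & context.

Fixpoint fill (xi : context) (x : formula) : formula :=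
  match xi with
  | Hole => x
  | DisjL k y => Disj (fill k x) y
  | DisjR y k => Disj y (fill k x)
  | ConjL k y => Conj (fill k x) y
  | ConjR y k => Conj y (fill k x)
  end.

(* A renaming is given by the images of the positive atoms, and is extended to
   the negative ones by commutation with negation; similarly a substitution is
   given by the images of the positive variables. *)
Fixpoint rename (rho : nat -> literal) (x : formula) : formula :=
  match x with
  | Ff => Ff
  | Tt => Tt
  | Atom a => Atom (if a.1 then rho a.2 else neg (rho a.2))
  | FVar v => FVar v
  | Disj y z => Disj (rename rho y) (rename rho z)
  | Conj y z => Conj (rename rho y) (rename rho z)
  end.

Fixpoint subst (sigma : nat -> formula) (x : formula) : formula :=
  match x with
  | Ff => Ff
  | Tt => Tt
  | Atom a => Atom a
  | FVar v => if v.1 then sigma v.2 else dual (sigma v.2)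
  | Disj y z => Disj (subst sigma y) (subst sigma z)
  | Conj y z => Conj (subst sigma y) (subst sigma z)
  end.

Inductive feq : formula -> formula -> Prop :=
| feq_refl x : feq x x
| feq_sym x y : feq x y -> feq y x
| feq_trans x y z : feq x y -> feq y z -> feq x z
| feq_ctx xi x y : feq x y -> feq (fill xi x) (fill xi y)
| feq_disjC x y : feq (Disj x y) (Disj y x)
| feq_conjC x y : feq (Conj x y) (Conj y x)
| feq_disjA x y z : feq (Disj (Disj x y) z) (Disj x (Disj y z))
| feq_conjA x y z : feq (Conj (Conj x y) z) (Conj x (Conj y z))
| feq_disjf x : feq (Disj x Ff) x
| feq_conjt x : feq (Conj x Tt) x
| feq_disjtt : feq (Disj Tt Tt) Tt
| feq_conjff : feq (Conj Ff Ff) Ff.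

(* (premiss, conclusion) *)
Definition rule : Type := (formula * formula)%type.

Definition system : Type := seq rule.

Definition instance (r : rule) (x y : formula) : Prop :=
  exists (rho : nat -> literal) (sigma : nat -> formula),
    x = subst sigma (rename rho r.1) /\ y = subst sigma (rename rho r.2).

Definition rule_step (S : system) (x y : formula) : Prop :=
  exists r xi u v,
    [/\ r \in S, instance r u v, x = fill xi u & y = fill xi v].

(* The flag [e] says whether the next step is an equality step. *)
Fixpoint alternating (S : system) (e : bool) (x : formula) (s : seq formula)
    : Prop :=
  match s with
  | [::] => True
  | y :: s' =>
      (if e then feq x y else rule_step S x y) /\ alternating S (~~ e) y s'
  end.

(* [p] is the whole chain, premiss and conclusion included; the first step may
   be of either kind. *)
Definition derivation (S : system) (x y : formula) (p : seq formula) : Prop :=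
  exists (e : bool) (s : seq formula),
    [/\ p = x :: s, last x s = y & alternating S e x s].

Definition dsize (p : seq formula) : nat := \sum_(x <- p) fsize x.

Definition proof (S : system) (y : formula) (p : seq formula) : Prop :=
  derivation S Tt y p.

Definition atomic_interaction : rule :=
  let a : literal := (true, 0) in (Tt, Disj (Atom a) (Atom (neg a))).

Definition atomic_weakening : rule :=
  let a : literal := (true, 0) in (Ff, Atom a).

Definition atomic_contraction : rule :=
  let a : literal := (true, 0) in (Disj (Atom a) (Atom a), Atom a).

Definition switch : rule :=
  let A := FVar (true, 0) in
  let B := FVar (true, 1) in
  let C := FVar (true, 2) in
  (Conj A (Disj B C), Disj (Conj A B) C).

Definition medial : rule :=
  let A := FVar (true, 0) in
  let B := FVar (true, 1) in
  let C := FVar (true, 2) in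
  let D := FVar (true, 3) in
  (Disj (Conj A B) (Conj C D), Conj (Disj A C) (Disj B D)).

Definition KS : system :=
  [:: atomic_interaction; atomic_weakening; atomic_contraction; switch; medial].

Section Statman.

Variables c d : nat -> literal.

Definition alpha (i : nat) : formula :=
  Disj (Atom (neg (c i))) (Atom (neg (d i))).

(* Meaningful for [k <= n]. *)
Fixpoint beta (n k : nat) : formula :=
  match n with
  | 0 => alpha k
  | m.+1 => if k < n then Conj (alpha n) (beta m k) else alpha k
  end.

Definition gamma (n k : nat) : formula := Conj (beta n k.+1) (Atom (c k)).

Definition delta (n k : nat) : formula := Conj (beta n k.+1) (Atom (d k)).

Fixpoint statman_tail (n k : nat) : formula :=
  match k with
  | 0 => alpha 1
  | m.+1 => Disj (Conj (gamma n k) (delta n k)) (statman_tail n m)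
  end.

(* Meaningful for [1 <= n]; the entries [c 0] and [d 0] are not used. *)
Definition statman (n : nat) : formula :=
  Disj (dual (alpha n)) (statman_tail n n.-1).

Lemma dual_alpha (i : nat) : dual (alpha i) = Conj (Atom (c i)) (Atom (d i)).
Proof. by rewrite /= !negK. Qed.

Lemma beta_diag (k : nat) : beta k k = alpha k.
Proof. by case: k => //= k; rewrite ltnn. Qed.

Lemma beta_rec (n k : nat) : k < n -> beta n k = Conj (alpha n) (beta n.-1 k).
Proof. by case: n => //= n ->. Qed.

Lemma fsize_beta (n k : nat) : k <= n -> fsize (beta n k) = 2 * (n - k).+1.
Proof.
elim: n => [|n IHn]; first by rewrite leqn0 => /eqP->.
rewrite leq_eqVlt => /predU1P[->|lt_kn]; first by rewrite beta_diag subnn.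
by rewrite beta_rec //= IHn //; lia.
Qed.

Lemma fsize_statman (n : nat) : 0 < n -> fsize (statman n) = 2 * n ^ 2 + 2.
Proof.
case: n => // n _; rewrite /statman /=.
suff tailE k : k <= n ->
    fsize (statman_tail n.+1 k) + 2 * k ^ 2 = 4 * k * n.+1 + 2 * 1.
  by have := tailE n (leqnn n); nia.
elim: k => [//|k IHk lt_kn].
have := @fsize_beta n.+1 k.+2 lt_kn; have := IHk (ltnW lt_kn).
by rewrite /=; nia.
Qed.

End Statman.

Definition bigO (f g : nat -> nat) : Prop :=
  exists K n0 : nat, forall n : nat, n0 <= n -> f n <= K * g n.

(* Main.v *)
(** Write [j * x] for a conjunction of [j] copies of [x].  There are
    proofs of [(c_i /\ d_i) \/ j * alpha_i] with O(j) rule steps: prove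
    [(c_i /\ d_i) \/ alpha_i] again for each copy, fuse the copies by switches,
    and contract the copies of [c_i /\ d_i] by medial and atomic contraction.
    Since [beta^n_k = alpha_k /\ beta^n_(k+1)], conjoining such a proof to
    [(j + 2) * beta^n_(k+1)] and pushing two copies of [beta^n_(k+1)] towards
    [c_k /\ d_k] by switches yields
    [(gamma^n_k /\ delta^n_k) \/ j * beta^n_k]; at the last level [k = 1] no
    further copy of beta is needed, and one gets
    [(gamma^n_1 /\ delta^n_1) \/ alpha_1].
    Each level thus consumes only two copies of beta, and starting from
    [(c_n /\ d_n) \/ 2(n-1) * alpha_n] one reaches [S_n] after n levels, that is
    O(n^2) rule steps on formulae of size O(n^2). *)
Require Import Defs.
From mathcomp Require Import all_boot.
From mathcomp Require Import zify.
From Stdlib Require Import Setoid Morphisms.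
Set Implicit Arguments.
Unset Strict Implicit.
Unset Printing Implicit Defensive.

(* Equality of formulae as a congruence *)
#[local] Hint Resolve feq_refl : core.

#[local] Instance feq_equivalence : Equivalence feq.
Proof.
by split; [exact: feq_refl | exact: feq_sym | exact: feq_trans].
Qed.

#[local] Instance Disj_proper : Proper (feq ==> feq ==> feq) Disj.
Proof.
move=> x x' xx' y y' yy'; apply: (feq_trans (y := Disj x' y)).
  exact: (feq_ctx (DisjL Hole y) xx').
exact: (feq_ctx (DisjR x' Hole) yy').
Qed.

#[local] Instance Conj_proper : Proper (feq ==> feq ==> feq) Conj.
Proof.
move=> x x' xx' y y' yy'; apply: (feq_trans (y := Conj x' y)).
  exact: (feq_ctx (ConjL Hole y) xx').
exact: (feq_ctx (ConjR x' Hole) yy').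
Qed.

Lemma feq_conjCA x y z : feq (Conj x (Conj y z)) (Conj y (Conj x z)).
Proof. by rewrite -!feq_conjA (feq_conjC x y). Qed.

Lemma feq_conjACA x y z w :
  feq (Conj (Conj x y) (Conj z w)) (Conj (Conj x z) (Conj y w)).
Proof. by rewrite !feq_conjA (feq_conjCA y). Qed.

Lemma feq_tconj x : feq (Conj Tt x) x.
Proof. by rewrite feq_conjC feq_conjt. Qed.

(** * Contexts, and rule steps inside them *)

Fixpoint comp (xi zeta : context) : context :=
  match xi with
  | Hole => zeta
  | DisjL k y => DisjL (comp k zeta) y
  | DisjR y k => DisjR y (comp k zeta)
  | ConjL k y => ConjL (comp k zeta) y
  | ConjR y k => ConjR y (comp k zeta)
  end.

Lemma fill_comp xi zeta x : fill (comp xi zeta) x = fill xi (fill zeta x).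
Proof. by elim: xi => //= [k -> y|y k ->|k -> y|y k ->]. Qed.

Fixpoint csize (xi : context) : nat :=
  match xi with
  | Hole => 0
  | DisjL k y | DisjR y k | ConjL k y | ConjR y k => csize k + fsize y
  end.

Lemma fsize_fill xi x : fsize (fill xi x) = csize xi + fsize x.
Proof. by elim: xi => //= [k -> y|y k ->|k -> y|y k ->]; lia. Qed.

Lemma rule_step_fill S xi x y :
  rule_step S x y -> rule_step S (fill xi x) (fill xi y).
Proof.
move=> [r [zeta [u [v [rS ruv -> ->]]]]].
by exists r, (comp xi zeta), u, v; rewrite !fill_comp.
Qed.

Lemma instance_step S r x y : r \in S -> instance r x y -> rule_step S x y.
Proof. by move=> rS ruv; exists r, Hole, x, y. Qed.

(** * Instances of the rules of [KS] *)

Lemma interaction_step l : rule_step KS Tt (Disj (Atom l) (Atom (neg l))).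
Proof.
apply: (@instance_step _ atomic_interaction); first by rewrite !inE eqxx.
by exists (fun=> l), (fun=> Ff).
Qed.

Lemma weakening_step l : rule_step KS Ff (Atom l).
Proof.
apply: (@instance_step _ atomic_weakening); first by rewrite !inE eqxx ?orbT.
by exists (fun=> l), (fun=> Ff).
Qed.

Lemma contraction_step l : rule_step KS (Disj (Atom l) (Atom l)) (Atom l).
Proof.
apply: (@instance_step _ atomic_contraction); first by rewrite !inE eqxx ?orbT.
by exists (fun=> l), (fun=> Ff).
Qed.

Lemma switch_step x y z :
  rule_step KS (Conj x (Disj y z)) (Disj (Conj x y) z).
Proof.
apply: (@instance_step _ switch); first by rewrite !inE eqxx ?orbT.
by exists (fun i => (true, i)), (nth Ff [:: x; y; z]).
Qed.

Lemma medial_step x y z w :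
  rule_step KS (Disj (Conj x y) (Conj z w)) (Conj (Disj x z) (Disj y w)).
Proof.
apply: (@instance_step _ medial); first by rewrite !inE eqxx ?orbT.
by exists (fun i => (true, i)), (nth Ff [:: x; y; z; w]).
Qed.

(** * Derivations with bounds on step count and formula size *)

(* At most [k] rule steps, all formulae of size at most [B].  Living in [Type]
   lets the proofs of the Statman tautologies be extracted without choice. *)
Inductive deriv (B : nat) : nat -> formula -> formula -> Type :=
| deriv_eq k x y : feq x y -> fsize x <= B -> fsize y <= B -> deriv B k x y
| deriv_step k x x' y z : feq x x' -> fsize x <= B -> fsize x' <= B ->
    rule_step KS x' y -> deriv B k y z -> deriv B k.+1 x z.

Lemma deriv_widen B B' k k' x y :
  B <= B' -> k <= k' -> deriv B k x y -> deriv B' k' x y.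
Proof.
move=> leB lek D; elim: D k' lek => {k x y} [k x y e xB yB|k x x' y z e xB x'B s _ IH].
  by move=> k' _; apply: deriv_eq e _ _; apply: leq_trans leB.
case=> [//|k'] lek; apply: (deriv_step e _ _ s (IH _ lek)) => //;
  exact: leq_trans leB.
Qed.

(** Consecutive equality steps merge by transitivity, so an equality put in front costs no rule
    step. *)
Lemma deriv_feql B k x y z :
  feq x y -> fsize x <= B -> deriv B k y z -> deriv B k x z.
Proof.
move=> xy xB D; case: D xy => {k y z} [k y z e _ zB|k y y' z w e _ y'B s D] xy.
  by apply: deriv_eq => //; rewrite xy.
by apply: deriv_step s D => //; rewrite xy.
Qed.

Lemma deriv_trans B k l x y z :
  deriv B k x y -> deriv B l y z -> deriv B (k + l) x z.
Proof.
move=> D E; elim: D E => {k x y} [k x y e xB _|k x x' y w e xB x'B s _ IH] E.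
  by apply: deriv_feql e xB _; apply: deriv_widen E => //; apply: leq_addl.
by rewrite addSn; apply: deriv_step s (IH E).
Qed.

Lemma deriv_size B k x y : deriv B k x y -> (fsize x <= B) && (fsize y <= B).
Proof.
elim=> {k x y} [k x y _ -> -> //|k x x' y z _ -> _ _ _ /andP[_ ->] //].
Qed.

Lemma deriv_feqr B k x y z :
  feq y z -> fsize z <= B -> deriv B k x y -> deriv B k x z.
Proof.
move=> e zB D; have /andP[_ yB] := deriv_size D.
by rewrite -[k]addn0; apply: deriv_trans D (deriv_eq _ e yB zB).
Qed.

Lemma deriv_rule B x y :
  rule_step KS x y -> fsize x <= B -> fsize y <= B -> deriv B 1 x y.
Proof.
by move=> s xB yB; apply: (deriv_step (feq_refl x)) s (deriv_eq 0 (feq_refl y) _ _).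
Qed.

Lemma deriv_fill B B' k xi x y :
  csize xi + B <= B' -> deriv B k x y -> deriv B' k (fill xi x) (fill xi y).
Proof.
move=> leB D; elim: D => {k x y} [k x y e xB yB|k x x' y z e xB x'B s _ IH].
  by apply: deriv_eq; [apply: feq_ctx | rewrite fsize_fill; lia ..].
apply: deriv_step (feq_ctx xi e) _ _ (rule_step_fill xi s) IH;
  by rewrite fsize_fill; lia.
Qed.

Lemma deriv_disjR B B' k u x y : fsize u + B <= B' ->
  deriv B k x y -> deriv B' k (Disj u x) (Disj u y).
Proof. by move=> leB; apply: (@deriv_fill _ _ _ (DisjR u Hole)). Qed.

Lemma deriv_disjL B B' k u x y : fsize u + B <= B' ->
  deriv B k x y -> deriv B' k (Disj x u) (Disj y u).
Proof. by move=> leB; apply: (@deriv_fill _ _ _ (DisjL Hole u)). Qed.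

Lemma deriv_conjR B B' k u x y : fsize u + B <= B' ->
  deriv B k x y -> deriv B' k (Conj u x) (Conj u y).
Proof. by move=> leB; apply: (@deriv_fill _ _ _ (ConjR u Hole)). Qed.

Lemma deriv_conjL B B' k u x y : fsize u + B <= B' ->
  deriv B k x y -> deriv B' k (Conj x u) (Conj y u).
Proof. by move=> leB; apply: (@deriv_fill _ _ _ (ConjL Hole u)). Qed.

Lemma deriv_conj B B' k l x x' y y' : B <= B' -> deriv B k x x' ->
  fsize x' + B <= B' -> B + fsize y <= B' ->
  deriv B l y y' -> deriv B' (k + l) (Conj x y) (Conj x' y').
Proof.
move=> leB D le1 le2 E.
by apply: deriv_trans (deriv_conjL _ D) (deriv_conjR le1 E); lia.
Qed.

(** Each rule step accounts for two formulae, the two sides of the equality before it; the closing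
    equality adds two more. Each has size at most [B]. *)
Lemma deriv_alternating B k x y : deriv B k x y ->
  {s | [/\ alternating KS true x s, last x s = y & dsize (x :: s) <= (2 * k + 2) * B]}.
Proof.
rewrite /dsize; elim=> {k x y} [k x y e xB yB|k x x' y z e xB x'B s _].
  by exists [:: y]; split => //; rewrite !big_cons big_nil; nia.
case=> t [alt_t last_t size_t]; exists [:: x', y & t]; split => //.
by move: size_t; rewrite !big_cons; nia.
Qed.

Lemma deriv_proof B k y : deriv B k Tt y ->
  {p | proof KS y p & dsize p <= (2 * k + 2) * B}.
Proof.
move=> /deriv_alternating[s [alt_s last_s size_s]].
by exists (Tt :: s) => //; exists true, s.
Qed.

(** One switch moves [v] out of the conjunction, a second one moves [u] out. *)
Lemma deriv_fuse B u v x y : fsize u + fsize v + fsize x + fsize y <= B ->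
  deriv B 2 (Conj (Disj u x) (Disj v y)) (Disj (Disj u v) (Conj x y)).
Proof.
move=> leB.
apply: (@deriv_feql _ _ _ (Conj (Disj u x) (Disj y v))); [|by rewrite /=; lia|].
  by rewrite (feq_disjC y).
apply: (@deriv_trans _ 1 1); first by apply: deriv_rule (switch_step _ _ _) _ _ => /=; lia.
apply: (@deriv_feql _ _ _ (Disj (Conj y (Disj x u)) v)); [|by rewrite /=; lia|].
  by rewrite (feq_disjC x) (feq_conjC y).
apply: (@deriv_feqr _ _ _ (Disj (Disj (Conj y x) u) v)); [|by rewrite /=; lia|].
  by rewrite feq_disjA feq_disjC (feq_conjC y).
by apply: deriv_rule; [apply: (rule_step_fill (DisjL Hole v)); apply: switch_step
  | rewrite /=; lia ..].
Qed.

(** * Conjunctions of copies of a formula *)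

Fixpoint conjn (x : formula) (j : nat) : formula :=
  if j is i.+1 then Conj x (conjn x i) else Tt.

Lemma fsize_conjn x j : fsize (conjn x j) = j * fsize x + 1.
Proof. by elim: j => //= j ->; lia. Qed.

Lemma conjn_double x j :
  conjn x (2 * j.+1) = Conj x (Conj x (conjn x (2 * j))).
Proof. by rewrite mulnS. Qed.

Lemma conjn_conj x y j :
  feq (conjn (Conj x y) j) (Conj (conjn x j) (conjn y j)).
Proof.
elim: j => /= [|j ->]; first by rewrite feq_conjt.
by rewrite feq_conjACA.
Qed.

Lemma feq_conjn x y j : feq x y -> feq (conjn x j) (conjn y j).
Proof. by move=> e; elim: j => //= j ->; rewrite e. Qed.

(** * Derivations for the Statman tautologies *)

Section Statman.

Variables c d : nat -> literal.

Let C i := Conj (Atom (c i)) (Atom (d i)).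

Lemma deriv_excluded_middle i : deriv 4 4 Tt (Disj (C i) (alpha c d i)).
Proof.
have D l : deriv 2 1 Tt (Disj (Atom (neg l)) (Atom l)).
  apply: (@deriv_feqr _ _ _ (Disj (Atom l) (Atom (neg l)))) => //.
    exact: feq_disjC.
  by apply: deriv_rule => //; apply: interaction_step.
apply: (@deriv_feql _ _ _ (Conj Tt Tt)) => //; first by rewrite feq_conjt.
apply: (@deriv_trans _ 2 2); first by apply: (deriv_conj _ (D (c i)) _ _ (D (d i))).
by apply: deriv_feqr (feq_disjC _ _) _ (deriv_fuse _).
Qed.

(** Medial pairs up equal atoms, which two atomic contractions then merge. *)
Lemma deriv_contraction i : deriv 4 3 (Disj (C i) (C i)) (C i).
Proof.
apply: (@deriv_trans _ 1 2); first by apply: deriv_rule (medial_step _ _ _ _) _ _.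
by apply: (@deriv_conj 2 _ 1 1) => //; apply: deriv_rule (contraction_step _) _ _.
Qed.

Lemma deriv_many i j :
  deriv (4 * j + 9) (9 * j + 2) Tt (Disj (C i) (conjn (alpha c d i) j)).
Proof.
elim: j => [|j IH].
  (* With no copy, [Tt] equals [Disj (Conj Ff Ff) Tt], and both [Ff] are weakened to the atoms of
     [C i]. *)
  apply: (@deriv_feql _ _ _ (Disj (Conj Ff Ff) Tt)) => //.
    by rewrite feq_conjff feq_disjC feq_disjf.
  apply: (@deriv_disjL 2) => //.
  by apply: (@deriv_conj 1 _ 1 1) => //; apply: deriv_rule (weakening_step _) _ _.
apply: (@deriv_feql _ _ _ (Conj Tt Tt)); [by rewrite feq_conjt | by [] |].
(* A further copy costs nine steps: four to prove it, two to fuse, three to contract. *)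
have -> : 9 * j.+1 + 2 = 4 + ((9 * j + 2) + (2 + 3)) by lia.
apply: deriv_trans.
  by apply: deriv_conjL (deriv_excluded_middle i); rewrite /=; lia.
apply: deriv_trans; first by apply: deriv_conjR IH; rewrite /=; lia.
apply: deriv_trans; first by apply: deriv_fuse; rewrite /= fsize_conjn /=; lia.
by apply: deriv_disjL (deriv_contraction i); rewrite /= fsize_conjn /=; lia.
Qed.

(** [beta] is defined by splitting off its top conjunct [alpha n]; the levels need the bottom one
    [alpha k] split off instead. *)
Lemma beta_recr n k : k < n ->
  feq (beta c d n k) (Conj (alpha c d k) (beta c d n k.+1)).
Proof.
elim: n => [//|n IH]; rewrite ltnS leq_eqVlt => /predU1P[->|lt_kn].
  by rewrite beta_rec ?ltnS //= !beta_diag feq_conjC /= ltnn.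
rewrite beta_rec ?ltnS 1?ltnW //= IH // ltnS lt_kn.
by rewrite feq_conjCA.
Qed.

(** Here [b] is meant to be the beta of the level and [p] its remaining copies. The proof from
    [deriv_many] replaces a unit; one switch brings both [b] to [C i], a second brings [p] to the
    copies of [alpha]. *)
Lemma deriv_level i j b p B : 2 * fsize b + fsize p + 4 * j + 9 <= B ->
  deriv B (9 * j + 4) (Conj b (Conj b p))
    (Disj (Conj (Conj b (Atom (c i))) (Conj b (Atom (d i))))
          (Conj p (conjn (alpha c d i) j))).
Proof.
move=> leB; set q := conjn _ j.
have q_size : fsize q = 2 * j + 1 by rewrite fsize_conjn /=; lia.
have -> : 9 * j + 4 = (9 * j + 2) + (1 + 1) by lia.
pose bb := Conj b b.
apply: (@deriv_feql _ _ _ (Conj (Conj p bb) Tt)); [|by rewrite /=; lia|].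
  by rewrite feq_conjt -feq_conjA feq_conjC.
apply: deriv_trans; first by apply: deriv_conjR (deriv_many i j); rewrite /=; lia.
rewrite -/q; apply: (@deriv_feql _ _ _ (Conj p (Conj bb (Disj (C i) q)))).
- by rewrite feq_conjA.
- by rewrite /=; lia.
apply: deriv_trans.
  apply: (@deriv_conjR (2 * fsize b + 4 * j + 9)); first by lia.
  by apply: deriv_rule (switch_step _ _ _) _ _; rewrite /=; lia.
apply: (@deriv_feql _ _ _ (Conj p (Disj q (Conj bb (C i))))).
- by rewrite (feq_disjC q).
- by rewrite /=; lia.
apply: (@deriv_feqr _ _ _ (Disj (Conj p q) (Conj bb (C i)))).
- by rewrite feq_disjC feq_conjACA.
- by rewrite /=; lia.
by apply: deriv_rule (switch_step _ _ _) _ _; rewrite /=; lia.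
Qed.

(** Each level takes at most [20 * n] steps and leaves behind a disjunct of size at most [6 * n],
    which stays as context for the later levels. *)
Lemma deriv_tail n k : k.+1 < n ->
  deriv (20 * n * n + 6 * n * k.+1) (20 * n * k.+1)
    (conjn (beta c d n k.+2) (2 * k.+1)) (statman_tail c d n k.+1).
Proof.
elim: k => [|k IH] lt_kn; rewrite conjn_double;
  have b_size := @fsize_beta c d n _ lt_kn; move: b_size; set b := beta _ _ _ _ => b_size.
  (* Last level: both copies of [b] are consumed, so [p] is [Tt], and a single [alpha 1] is kept. *)
  apply: (@deriv_feqr _ _ _ (Disj (Conj (gamma c d n 1) (delta c d n 1))
      (Conj Tt (conjn (alpha c d 1) 1)))).
  - by rewrite /= feq_tconj feq_conjt.
  - by rewrite /= -/b; nia.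
  apply: (@deriv_widen _ _ (9 * 1 + 4)); last exact: deriv_level (leqnn _).
    by rewrite /=; nia.
  by nia.
have b_le : fsize b <= 2 * n by lia.
have n_le : n <= n * n by rewrite leq_pmull //; lia.
set p := conjn b _; have p_size : fsize p <= 4 * (n * n) + 1.
  rewrite fsize_conjn leq_add2r.
  by rewrite (_ : 4 * (n * n) = 2 * n * (2 * n)) ?leq_mul //; lia.
move: (IH (ltnW lt_kn)); set q := conjn (beta c d n k.+2) _ => {}IH.
have q_size : fsize q <= 4 * (n * n) + 1.
  rewrite fsize_conjn fsize_beta ?(ltnW lt_kn) // leq_add2r.
  by rewrite (_ : 4 * (n * n) = 2 * n * (2 * n)) ?leq_mul //; lia.
apply: (@deriv_widen _ _ ((9 * (2 * k.+1) + 4) + 20 * n * k.+1) _ _ _ (leqnn _)).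
  by nia.
apply: deriv_trans; last first.
  by apply: deriv_disjR IH; rewrite /= -/b; nia.
apply: (@deriv_feqr _ _ _ (Disj (Conj (gamma c d n k.+2) (delta c d n k.+2))
    (Conj p (conjn (alpha c d k.+2) (2 * k.+1))))).
(* Pairing each remaining [b] with a new [alpha] gives the copies of [beta] for the next level. *)
- by rewrite /q (feq_conjn _ (beta_recr lt_kn)) conjn_conj (feq_conjC (conjn _ _)).
- by rewrite -[fsize (Disj _ _)]/(fsize b + 1 + (fsize b + 1) + fsize q); nia.
by apply: deriv_level; nia.
Qed.

Lemma deriv_statman n : 0 < n -> deriv (30 * n * n) (40 * n * n) Tt (statman c d n).
Proof.
rewrite /statman dual_alpha; case: n => [//|[_|n _]].
  (* For n = 1 there is no level to descend: one copy of [alpha 1] suffices. *)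
  apply: (@deriv_widen 13 _ 11) => //.
  apply: deriv_feqr (deriv_many 1 1) => //.
  by rewrite /= feq_conjt.
(* Since [beta n n] is [alpha n], the tail starts from the copies that [deriv_many] supplies; the 2
   in the size bound below is the disjunct [C n]. *)
have tail := @deriv_tail n.+2 n (ltnSn _); rewrite beta_diag in tail.
apply: (@deriv_widen (2 + (20 * n.+2 * n.+2 + 6 * n.+2 * n.+1)) _
  ((9 * (2 * n.+1) + 2) + 20 * n.+2 * n.+1)); [by nia | by nia |].
apply: deriv_trans (deriv_disjR _ tail) => //.
by apply: deriv_widen (deriv_many _ _) => //; nia.
Qed.

End Statman.

Theorem theorem3p12 (c d : nat -> literal) :
  exists Pi : nat -> seq formula,
    (forall n : nat, 1 <= n -> proof KS (statman c d n) (Pi n)) /\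
    bigO (fun n => dsize (Pi n)) (fun n => fsize (statman c d n) ^ 2).
Proof.
(* The empty chain is a default value at n = 0, outside the range of the tautologies. *)
exists (fun n => if n is m.+1 then s2val (deriv_proof (@deriv_statman c d m.+1 isT))
                 else [::]); split.
  by case=> // n _; case: deriv_proof.
(* With x = n, the size is at most (80x^2 + 2) * 30x^2, below 1000 * (2x^2 + 2)^2. *)
exists 1000, 1; case=> // n _; rewrite fsize_statman //.
case: deriv_proof => p _ /= /leq_trans; apply.
set x := n.+1; have -> : 40 * x * x = 40 * x ^ 2 by lia.
have -> : 30 * x * x = 30 * x ^ 2 by lia.
by move: (x ^ 2) => y; nia.
Qed.
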